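(* There is an absolute constant $c > 0$ such that for all integers $p \ge 1$ and $n \ge p$ with $n$ a multiple of $p$, in the universal emptying game on $p$ processors and $n$ cups there is an adaptive filler strategy which, against every emptier, ensures that after step $\frac{n}{p}-1$ some cup contains at least $c\log\frac{n}{p}$ units of water.
   Context: Universal emptying game on $p$ processors and $n$ cups: $n$ cups, initially empty. In each step the filler distributes $p/2$ units of water among the cups (with no per-cup limit), and then the emptier selects $p$ cups and removes all of the water from each of them. An adaptive filler may base its choices on the emptier's previous actions. *)

(* Defs.v *)
From HB Require Import structures.
From mathcomp Require Import all_boot all_order all_algebra.
From mathcomp Require Import reals exp.

Set Implicit Arguments.
Unset Strict Implicit.
Unset Printing Implicit Defensive.

Import Order.TTheory GRing.Theory Num.Theory.
Local Open Scope ring_scope.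

(* In the comments below, a step is a pair (f, S): f i is the amount of water
   the filler adds to cup i, and S is the set of cups the emptier then empties. *)

Definition legal_fill (R : realType) (n p : nat) (f : {ffun 'I_n -> R}) : Prop :=
  (forall i, 0 <= f i) /\ \sum_(i < n) f i = p%:R / 2.

Definition history (R : realType) (n : nat) : Type :=
  seq ({ffun 'I_n -> R} * {set 'I_n}).

(* The filler sees the emptier's previous actions, in chronological order; its
   own previous fills are determined by them. *)
Definition filler (R : realType) (n : nat) : Type :=
  seq {set 'I_n} -> {ffun 'I_n -> R}.

Definition legal_filler (R : realType) (n p : nat) (F : filler R n) : Prop :=
  forall s, legal_fill p (F s).

(* The emptier sees all previous steps and the current fill. *)
Definition emptier (R : realType) (n : nat) : Type :=
  history R n -> {ffun 'I_n -> R} -> {set 'I_n}.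

Definition legal_emptier (R : realType) (n p : nat) (E : emptier R n) : Prop :=
  forall h f, #|E h f| = p.

Fixpoint play (R : realType) (n : nat) (F : filler R n) (E : emptier R n)
    (t : nat) : history R n :=
  if t is t'.+1 then
    let h := play F E t' in
    let f := F [seq a.2 | a <- h] in
    rcons h (f, E h f)
  else [::].

Definition step (R : realType) (n : nat) (w : {ffun 'I_n -> R})
    (a : {ffun 'I_n -> R} * {set 'I_n}) : {ffun 'I_n -> R} :=
  [ffun i => if i \in a.2 then 0 else w i + a.1 i].

(* Water in each cup after step t, i.e. once the emptier has emptied its cups. *)
Definition water (R : realType) (n : nat) (F : filler R n) (E : emptier R n)
    (t : nat) : {ffun 'I_n -> R} :=
  foldl (@step R n) [ffun=> 0] (play F E t).

(* Main.v *)
(** Let [k = n / p]. The filler maintains a nested family of sets [A_t] of exactly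
    [(k - t) p] cups that have never been emptied, and spreads its water evenly
    over [A_t]: each such cup receives [1 / (2 (k - t))], which is at least
    [(ln (k - t) - ln (k - t - 1)) / 4]. These bounds telescope, so that a cup of
    [A_{k-1}], a set of size [p >= 1], ends up with at least [ln k / 4].
    If the emptier wastes moves on cups outside [A_t], the filler discards cups,
    since spreading over too large a set would make the sum bounded. *)
Require Import Defs.
From mathcomp Require Import all_boot all_order all_algebra.
From mathcomp Require Import reals exp.
From mathcomp Require Import ring lra zify.

Set Implicit Arguments.
Unset Strict Implicit.
Unset Printing Implicit Defensive.

Import Order.TTheory GRing.Theory Num.Theory.
Local Open Scope ring_scope.

(** Truncating with [take] makes the size independent of how many cups of [A] the emptier hits. *)
Definition retain (T : finType) (p : nat) (A S : {set T}) : {set T} :=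
  [set x in take (#|A| - p) (enum (A :\: S))].

Lemma retain_sub (T : finType) p (A S : {set T}) : retain p A S \subset A :\: S.
Proof. by apply/subsetP => x; rewrite inE => /mem_take; rewrite mem_enum. Qed.

Lemma card_retain (T : finType) p (A S : {set T}) :
  (#|S| <= p)%N -> #|retain p A S| = (#|A| - p)%N.
Proof.
move=> Sp; rewrite cardsE (card_uniqP _) ?take_uniq ?enum_uniq //.
rewrite size_takel // -cardE cardsD leq_sub2l //.
exact: leq_trans (subset_leq_card (subsetIr A S)) Sp.
Qed.

Definition active (n : nat) (p : nat) (s : seq {set 'I_n}) : {set 'I_n} :=
  foldl (retain p) setT s.

(* The fallback to [setT] only serves legality on histories that outlast the game. *)
Definition support_cups (n : nat) (p : nat) (s : seq {set 'I_n}) : {set 'I_n} :=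
  if active p s == set0 then setT else active p s.

Definition even_filler (R : realType) (n p : nat) : filler R n :=
  fun s => [ffun i => if i \in support_cups p s
                      then p%:R / 2 / #|support_cups p s|%:R else 0].

Lemma even_filler_legal (R : realType) n p :
  (0 < n)%N -> legal_filler p (@even_filler R n p).
Proof.
move=> n_gt0 s; split=> [i|].
  by rewrite ffunE; case: ifP => // _; rewrite !divr_ge0.
under eq_bigr do rewrite ffunE.
have U_gt0 : (0 < #|support_cups p s|)%N.
  rewrite /support_cups; case: eqVneq => [_|]; first by rewrite cardsT card_ord.
  by rewrite card_gt0.
rewrite -big_mkcond sumr_const -[LHS]mulr_natr divfK //.
by rewrite pnatr_eq0 -lt0n.
Qed.

(** The increment is [ln (1 + 1/m)], at most [1/m], and [m + 1 <= 2 m]. The factor 2 lost here is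
    what makes the final constant [1 / 4]. *)
Lemma ln_increment_le (R : realType) (m : nat) : (0 < m)%N ->
  ln (m.+1%:R : R) - ln m%:R <= 2 / m.+1%:R.
Proof.
move=> m_gt0; have m0 : 0 < m%:R :> R by rewrite ltr0n.
have m1 : 1 <= m%:R :> R by rewrite ler1n.
rewrite -ln_div ?posrE ?ltr0n //.
have -> : m.+1%:R / m%:R = 1 + m%:R^-1 :> R.
  by rewrite -natr1 mulrDl divff ?gt_eqF // mul1r.
apply: le_trans (le_ln1Dx _) _.
  by apply: lt_le_trans (ltrN10 _) _; rewrite invr_ge0 ltW.
rewrite ler_pdivlMr ?ltr0n // mulrC ler_pdivrMr // -natr1; lra.
Qed.

Section Play.
Variables (R : realType) (n p k : nat) (E : emptier R n).
Hypotheses (p_gt0 : (0 < p)%N) (nE : n = (k * p)%N) (E_legal : legal_emptier p E).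

Let F := @even_filler R n p.
Let emptied t := [seq a.2 | a <- play F E t].

Lemma active_invariant t : (t < k)%N ->
  #|active p (emptied t)| = ((k - t) * p)%N /\
  forall i, i \in active p (emptied t) ->
    (ln k%:R - ln (k - t)%:R) / 4 <= water F E t i.
Proof.
elim: t => [|t IH] lt_tk.
  rewrite subn0 /active cardsT card_ord; split=> // i _.
  by rewrite /water /= ffunE subrr mul0r.
have [cardA waterA] := IH (ltnW lt_tk).
rewrite /emptied /= map_rcons -/(emptied t) /active foldl_rcons -/(active _ _) /=.
set A := active p _ in cardA waterA *.
have [m km m_gt0] : exists2 m, (k - t)%N = m.+1 & (0 < m)%N.
  by exists (k - t.+1)%N; lia.
have -> : (k - t.+1)%N = m by lia.
rewrite km in cardA waterA.
split=> [|i]; first by rewrite card_retain ?E_legal // cardA mulSn addKn.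
move=> /(subsetP (retain_sub _ _ _)); rewrite inE => /andP[iS iA].
rewrite /water /= foldl_rcons ffunE /= (negPf iS) -/(water F E t).
(* [A] has [m.+1 * p > 0] cups, so the fallback to [setT] is not triggered. *)
have UE : support_cups p (emptied t) = A.
  by rewrite /support_cups -/A -cards_eq0 cardA; case: eqP => //; lia.
rewrite ffunE UE iA cardA.
have := waterA i iA; have := @ln_increment_le R m m_gt0.
(* The share of each cup is a quarter of the bound on the logarithmic increment, so one step of the
   telescoping sum is paid for. *)
have -> : p%:R / 2 / (m.+1 * p)%:R = 2 / m.+1%:R / 4 :> R.
  by rewrite natrM; field; rewrite nat1r !pnatr_eq0 -!lt0n p_gt0.
set d := 2 / _; lra.
Qed.

End Play.

Theorem theorem8p1 (R : realType) :
  exists c : R, 0 < c /\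
    forall p n : nat, (1 <= p)%N -> (p <= n)%N -> (p %| n)%N ->
      exists F : filler R n, legal_filler p F /\
        forall E : emptier R n, legal_emptier p E ->
          exists i : 'I_n,
            c * ln (n%:R / p%:R) <= water F E (n %/ p - 1) i.
Proof.
exists (1 / 4); split; first by rewrite divr_gt0.
move=> p n p_gt0 le_pn /dvdnP[k nE].
exists (@even_filler R n p); split.
  by apply: even_filler_legal; apply: leq_trans le_pn.
move=> E E_legal.
have k_gt0 : (0 < k)%N by case: k nE le_pn => // ->; lia.
have [|cardA waterA] := @active_invariant R n p k E p_gt0 nE E_legal (k - 1)%N.
  by lia.
have {}cardA := etrans cardA (congr1 (muln^~ p) (subKn k_gt0)).
have [i iA] :
    exists i, i \in active p [seq a.2 | a <- play (@even_filler R n p) E (k - 1)].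
  by apply/card_gt0P; rewrite cardA mul1n.
exists i; have := waterA i iA.
(* At [t = k - 1] the subtracted logarithm is [ln 1 = 0], which leaves [ln k / 4]. *)
rewrite subKn // ln1 subr0.
have -> : (n %/ p = k)%N by rewrite nE mulnK.
have -> : n%:R / p%:R = k%:R :> R by rewrite nE natrM mulfK // pnatr_eq0 -lt0n.
by rewrite mulrC mul1r.
Qed.
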